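(* Let $A\in\mathbb{R}^{n\times n}$ and consider the continuous-time linear dynamical system $\dot x=Ax$. Suppose there exists a positive definite polynomial $V:\mathbb{R}^n\to\mathbb{R}$ such that the polynomial $-\dot V(x)=-\langle\nabla V(x),Ax\rangle$ is positive definite and a sum of squares. Then $V$ is a sum of squares.
   Context: A function $V:\mathbb{R}^n\to\mathbb{R}$ is positive definite if $V(x)>0$ for all $x\neq 0$. A polynomial is a sum of squares (sos) if it equals $\sum_i q_i^2$ for finitely many real polynomials $q_i$. *)

(* Defs.v *)
From HB Require Import structures.
From mathcomp Require Import all_boot all_order all_algebra.
From mathcomp Require Import mpoly.
From mathcomp Require Import reals.

Set Implicit Arguments.
Unset Strict Implicit.
Unset Printing Implicit Defensive.

Import Order.TTheory GRing.Theory Num.Theory.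
Local Open Scope ring_scope.

(* The value at 0 is not constrained. *)
Definition positive_definite (R : realType) (n : nat) (f : 'cV[R]_n -> R) : Prop :=
  forall x : 'cV[R]_n, x != 0 -> 0 < f x.

Definition mpoly_fun (R : realType) (n : nat) (p : {mpoly R[n]}) (x : 'cV[R]_n) : R :=
  p.@[fun i => x i ord0].

Definition sos (R : realType) (n : nat) (p : {mpoly R[n]}) : Prop :=
  exists qs : seq {mpoly R[n]}, p = \sum_(q <- qs) q ^+ 2.

Definition gradient (R : realType) (n : nat) (p : {mpoly R[n]}) :
    'cV[{mpoly R[n]}]_n :=
  \col_i p^`M(i).

(* Polynomial vector fields on R^n are columns of polynomials;
   [linear_field A] is x |-> A x. *)
Definition linear_field (R : realType) (n : nat) (A : 'M[R]_n) :
    'cV[{mpoly R[n]}]_n :=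
  map_mx (@mpolyC n R) A *m \col_i 'X_i.

(* <grad V, f>, the derivative of V along the solutions of x' = f(x). *)
Definition orbital_derivative (R : realType) (n : nat)
    (f : 'cV[{mpoly R[n]}]_n) (V : {mpoly R[n]}) : {mpoly R[n]} :=
  \sum_(i < n) gradient V i ord0 * f i ord0.

(* Main.v *)
Require Import Defs.
From HB Require Import structures.
From mathcomp Require Import all_boot all_order all_algebra.
From mathcomp Require Import cyclic separable cyclotomic ring.
From mathcomp Require Import mpoly complex polyorder polyrcf.
From mathcomp Require Import reals.
Import Order.TTheory GRing.Theory Num.Theory.
Local Open Scope ring_scope.

(** Write [D V] for the derivative of [V] along the vector field [x |-> A x]. It is a
    derivation of the polynomial ring, and [S = - D V] is a sum of squares [q ^+ 2].

    If [A] is Hurwitz, then [V x = V 0 + \int_0^oo S (exp (t A) x) dt], and the integral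
    is a sum of squares because each [q \o exp (t A)] is a polynomial and the cone of
    sums of squares of bounded degree is closed. The proof below replaces this integral
    by an algebraic construction: for every [q] without constant term it produces
    a sum of squares [T] without constant term with [- D T = q ^+ 2]. Summing these [T]
    gives [V] up to a constant, since the kernel of [D] consists of the constants, and
    that constant [V 0] is nonnegative.

    The construction works over the complex numbers, with squares replaced by
    [g * conj g] (lemma [hermitian_square_primitive]). When [A] is Hurwitz, a polynomial
    [q] without constant term is killed by a product of operators [D - mu] with
    [Re mu < 0] (lemma [stable_torsion_mcoeff0]), by Cayley-Hamilton for linear forms
    and the Leibniz rule for products. If only one factor [D - mu] is needed, then
    [D (q * conj q) = (2 * Re mu) *: (q * conj q)], and one rescales. In general [q] is
    corrected by a [t] that is killed by one factor less, so that
    [g = q + t] satisfies [- D (g * conj g) = - (2 * Re mu) *: (q * conj q - t * conj t)],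
    and one goes on with [t].

    That [A] is Hurwitz (lemma [hurwitz_of_lyapunov]) is the converse use of [V]. Let
    [v] be an eigenvector for the eigenvalue [mu]. On the points [2 * Re (z v)], [z]
    complex, the flow multiplies [z] by [exp (t mu)]. Averaging over the argument of [z]
    turns [V] into a polynomial [P] in the squared modulus [r] of [z], and [D V] into
    [2 * Re mu * r * P^`().[r]]. So [P] is positive on the positive half-line while
    [Re mu * P^`()] is negative there. This excludes [Re mu >= 0], for a polynomial which
    decreases on the whole half-line takes negative values. The average is a finite one,
    over roots of unity of an order that exceeds the degree. *)

Set Implicit Arguments.
Unset Strict Implicit.
Unset Printing Implicit Defensive.

(** * Torsion elements of a linear operator *)

(** Stands for [(\prod_(mu <- s) (D - mu)) x = 0]. *)
Fixpoint annihilates (K : fieldType) (E : lmodType K) (D : E -> E)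
    (s : seq K) (x : E) : Prop :=
  if s is mu :: s' then annihilates D s' (D x - mu *: x) else x = 0.

Section Annihilators.
Variables (K : fieldType) (E : lmodType K) (D : {linear E -> E}).
Implicit Types (x y : E) (s t : seq K).
Local Notation annihilates := (annihilates D).

Lemma annihilates0 s : annihilates s 0.
Proof. by elim: s => //= mu s IHs; rewrite linear0 scaler0 subrr. Qed.

Lemma annihilatesP s c x y :
  annihilates s x -> annihilates s y -> annihilates s (c *: x + y).
Proof.
elim: s x y => [|mu s IHs] x y /=; first by move=> -> ->; rewrite scaler0 addr0.
move=> hx hy; rewrite linearP.
suff -> : c *: D x + D y - mu *: (c *: x + y)
          = c *: (D x - mu *: x) + (D y - mu *: y) by exact: IHs.
by rewrite scalerBr !scalerDr !scalerA (mulrC mu) opprD addrACA.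
Qed.

Lemma annihilatesZ s c x : annihilates s x -> annihilates s (c *: x).
Proof.
by move=> hx; rewrite -[c *: x]addr0; apply: annihilatesP (annihilates0 s).
Qed.

Lemma annihilatesD s x y :
  annihilates s x -> annihilates s y -> annihilates s (x + y).
Proof. by move=> hx hy; rewrite -[x]scale1r; apply: annihilatesP. Qed.

Lemma annihilates_stable s x : annihilates s x -> annihilates s (D x).
Proof.
elim: s x => [|mu s IHs] x /=; first by move=> ->; rewrite linear0.
by move=> /IHs; rewrite linearB linearZ.
Qed.

Lemma annihilates_shift s mu x :
  annihilates s x -> annihilates s (D x - mu *: x).
Proof.
move=> hx; rewrite addrC -scaleNr.
by apply: annihilatesP => //; apply: annihilates_stable.
Qed.

Lemma annihilates_catl s t x : annihilates s x -> annihilates (s ++ t) x.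
Proof.
by elim: s x => [|mu s IHs] x /=; [move=> ->; apply: annihilates0 | apply: IHs].
Qed.

Lemma annihilates_catr s t x : annihilates t x -> annihilates (s ++ t) x.
Proof.
by elim: s x => [|mu s IHs] x //= /(annihilates_shift mu); apply: IHs.
Qed.

(** Since ['X - c] is coprime to the product of the ['X - mu], the operator [D - c] is
    invertible on the vectors that this product kills. *)
Lemma annihilates_solve s c x : c \notin s -> annihilates s x ->
  exists2 y, annihilates s y & D y - c *: y = x.
Proof.
have shiftB a u v : D (u - v) - a *: (u - v) = (D u - a *: u) - (D v - a *: v).
  by rewrite linearB scalerBr !opprD !opprK addrACA.
have shift_sub a b u : (D u - a *: u) - (D u - b *: u) = (b - a) *: u.
  by rewrite opprB addrC addrA subrK scalerBl.
elim: s x => [|mu s IHs] x.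
  by move=> _ /= ->; exists 0; [|rewrite linear0 scaler0 subrr].
rewrite inE negb_or => /andP[c_neq_mu /IHs{}IHs] /= hx.
have [z hz Dz] := IHs _ hx.
have e_neq0 : mu - c != 0 by rewrite subr_eq0 eq_sym.
(* [(D - c) z = (D - mu) x], hence [(D - c) (x - z) = (D - c) x - (D - mu) x],
   which is the multiple [mu - c] of [x]. *)
exists ((mu - c)^-1 *: (x - z)).
  suff -> : D ((mu - c)^-1 *: (x - z)) - mu *: ((mu - c)^-1 *: (x - z)) = z by [].
  rewrite linearZ scalerA mulrC -scalerA -scalerBr shiftB -{}Dz shift_sub.
  by rewrite scalerK.
rewrite linearZ scalerA mulrC -scalerA -scalerBr shiftB Dz shift_sub.
by rewrite scalerK.
Qed.

Lemma annihilates_ker s x : 0 \notin s -> annihilates s x -> D x = 0 -> x = 0.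
Proof.
elim: s x => [|mu s IHs] x //; rewrite inE negb_or => /andP[mu_neq0 s0] /= hx Dx0.
move: hx; rewrite Dx0 sub0r -scaleNr => hx.
have : - mu *: x = 0 by apply: IHs => //; rewrite linearZ Dx0 /= scaler0.
by move/eqP; rewrite scaler_eq0 oppr_eq0 eq_sym (negPf mu_neq0) => /eqP.
Qed.

End Annihilators.

(** The eigenvalues of a derivation add up on products:
    [(D - (mu + nu)) (x * y)] is [((D - mu) x) * y + x * ((D - nu) y)], and in each of
    the two terms one factor is killed by a shorter product. *)
Lemma annihilatesM (K : fieldType) (E : comAlgType K) (D : {linear E -> E})
    (Dmul : forall x y, D (x * y) = D x * y + x * D y)
    (P : K -> Prop) (Padd : forall a b, P a -> P b -> P (a + b))
    (s t : seq K) (x y : E) :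
  {in s, forall a, P a} -> {in t, forall a, P a} ->
  annihilates D s x -> annihilates D t y ->
  exists2 u, {in u, forall a, P a} & annihilates D u (x * y).
Proof.
elim: s t x y => [|mu s IHs] t x y.
  by move=> _ _ -> _; exists [::]; rewrite //= mul0r.
move=> Ps.
have Ps' : {in s, forall a, P a} by move=> a sa; apply: Ps; rewrite inE sa orbT.
have Pmu : P mu by apply: Ps; rewrite inE eqxx.
elim: t y => [|nu t IHt] y; first by move=> _ _ ->; exists [::]; rewrite //= mulr0.
move=> Pt hx hy.
have Pt' : {in t, forall a, P a} by move=> a ta; apply: Pt; rewrite inE ta orbT.
have Pnu : P nu by apply: Pt; rewrite inE eqxx.
have [u1 Pu1 hu1] := IHs (nu :: t) (D x - mu *: x) y Ps' Pt hx hy.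
have [u2 Pu2 hu2] := IHt (D y - nu *: y) Pt' hx hy.
exists ((mu + nu) :: (u1 ++ u2)).
  move=> a; rewrite inE mem_cat => /orP[/eqP -> | /orP[/Pu1 // | /Pu2 //]].
  exact: Padd.
have -> : annihilates D (mu + nu :: u1 ++ u2) (x * y)
        = annihilates D (u1 ++ u2) ((D x - mu *: x) * y + x * (D y - nu *: y)).
  rewrite /= Dmul; congr annihilates.
  rewrite mulrBl mulrBr -scalerAl -scalerAr scalerDl opprD.
  by rewrite addrACA.
by apply: annihilatesD; [apply: annihilates_catl | apply: annihilates_catr].
Qed.

(** * The derivation of the polynomial ring along a linear vector field *)

Section Derivation.
Variables (n : nat) (K : comNzRingType).
Implicit Types (A : 'M[K]_n) (p q : {mpoly K[n]}).

Lemma mpoly_ring_ind (P : {mpoly K[n]} -> Prop) :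
  (forall c, P c%:MP) -> (forall i, P 'X_i) ->
  (forall p q, P p -> P q -> P (p + q)) ->
  (forall p q, P p -> P q -> P (p * q)) -> forall p, P p.
Proof.
move=> PC PX PD PM p; rewrite (mpolyE p); elim/big_rec: _ => [|m q _ Pq].
  by rewrite -mpolyC0.
apply: PD => //; rewrite -mul_mpolyC; apply: (PM) => //.
rewrite mpolyXE_id; elim/big_rec: _ => [|i q' _ Pq']; first by rewrite -mpolyC1.
apply: (PM) => //; elim: (m i) => [|k IHk]; first by rewrite expr0 -mpolyC1.
by rewrite exprS; apply: PM.
Qed.

Definition linear_form (u : 'rV[K]_n) : {mpoly K[n]} := \sum_j u 0 j *: 'X_j.

(** The derivative of [p] along [x |-> A x], over any commutative ring since it is used
    over the complex numbers and in two variables as well. *)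
Definition lie A p : {mpoly K[n]} := \sum_i p^`M(i) * linear_form (row i A).

Fact lie_is_linear A : linear (lie A).
Proof.
move=> c p q; rewrite /lie scaler_sumr -big_split; apply: eq_bigr => i _ /=.
by rewrite mderivD mderivZ mulrDl scalerAl.
Qed.
HB.instance Definition _ A :=
  GRing.isLinear.Build K {mpoly K[n]} {mpoly K[n]} _ (lie A) (lie_is_linear A).

Lemma lieM A p q : lie A (p * q) = lie A p * q + p * lie A q.
Proof.
rewrite /lie mulr_suml mulr_sumr -big_split; apply: eq_bigr => i _ /=.
by rewrite mderivM; ring.
Qed.

Lemma lieC A c : lie A c%:MP = 0.
Proof. by rewrite /lie big1 // => i _; rewrite mderivC mul0r. Qed.

Lemma lieX A i : lie A 'X_i = linear_form (row i A).
Proof.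
rewrite /lie (bigD1 i) //= big1 ?addr0 => [|j ji].
  by rewrite mderivX mnm1E eqxx scale1r -[X in (X - _)%MM]add0m addmK mpolyX0 mul1r.
by rewrite mderivX mnm1E eq_sym (negPf ji) scale0r mul0r.
Qed.

Lemma lie_linear_form A u : lie A (linear_form u) = linear_form (u *m A).
Proof.
rewrite linear_sum /=.
under eq_bigr do rewrite linearZ /= lieX scaler_sumr.
rewrite exchange_big; apply: eq_bigr => j _ /=.
rewrite mxE scaler_suml; apply: eq_bigr => i _.
by rewrite scalerA mxE.
Qed.

Lemma lie_mcoeff0 A p : (lie A p)@_0%MM = 0.
Proof.
rewrite /lie raddf_sum /= big1 // => i _.
rewrite mulr_sumr raddf_sum /= big1 // => j _.
by rewrite -scalerAr mcoeffZ rmorphM /= mcoeffX -mdeg_eq0 mdeg1 !mulr0.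
Qed.

End Derivation.

Lemma lie_map (K L : comNzRingType) (f : {rmorphism K -> L}) n (A : 'M[K]_n) p :
  map_mpoly f (lie A p) = lie (map_mx f A) (map_mpoly f p).
Proof.
elim/mpoly_ring_ind: p => [c|i|p q IHp IHq|p q IHp IHq].
- by rewrite lieC rmorph0 map_mpolyC lieC.
- rewrite lieX map_mpolyX lieX /linear_form rmorph_sum /=; apply: eq_bigr => j _.
  by rewrite map_mpolyZ map_mpolyX !mxE.
- by rewrite !(linearD, rmorphD) /= IHp IHq.
- by rewrite rmorphM !lieM rmorphD !rmorphM /= IHp IHq.
Qed.

(** Both sides are derivations along the substitution, so they agree as soon as they
    agree on the variables. *)
Lemma lie_comp (K : comNzRingType) n m (A : 'M[K]_n) (B : 'M[K]_m)
    (lq : n.-tuple {mpoly K[m]}) p :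
  (forall i, lie B (tnth lq i) = lie A 'X_i \mPo lq) ->
  lie B (p \mPo lq) = lie A p \mPo lq.
Proof.
move=> hlq; elim/mpoly_ring_ind: p => [c|i|p q IHp IHq|p q IHp IHq].
- by rewrite comp_mpolyC !lieC comp_mpoly0.
- by rewrite comp_mpolyXU -tnth_nth.
- by rewrite !(linearD, comp_mpolyD) /= IHp IHq.
- by rewrite rmorphM !lieM /= rmorphD !rmorphM /= IHp IHq.
Qed.

(** * Primitives of Hermitian squares *)

Local Open Scope complex_scope.
(* The unqualified names denote the projections of a numClosedFieldType,
   whose values are complex numbers. *)
Local Notation Re := complex.Re.
Local Notation Im := complex.Im.

(** The mixed terms [q * t'] and [t * q'] cancel because [g = q + t] has derivative
    [m *: q - m' *: t]. *)
Lemma hermitian_step (K : comNzRingType) (E : comAlgType K) (m m' : K) (q t q' t' : E) :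
  (m *: q - m' *: t) * (q' + t') + (q + t) * (m' *: q' - m *: t')
  = (m + m') *: (q * q' - t * t').
Proof.
(* The identity in a bare ring; scalars enter it as multiples of 1. *)
have ringE (E' : comNzRingType) (a a' x y x' y' : E') :
    (a * x - a' * y) * (x' + y') + (x + y) * (a' * x' - a * y')
    = (a + a') * (x * x' - y * y') by ring.
have scaleE c (x : E) : c *: x = c%:A * x by rewrite mulr_algl.
rewrite (scaleE m q) (scaleE m' t) (scaleE m' q') (scaleE m t').
by rewrite (scaleE (m + m')) scalerDl; apply: ringE.
Qed.

Section HermitianSquares.
Variables (R : rcfType) (E : comAlgType R[i]) (D : {linear E -> E}).
Variable conj : {rmorphism E -> E}.
Hypothesis Dmul : forall x y, D (x * y) = D x * y + x * D y.
Hypothesis conjZ : forall (c : R[i]) x, conj (c *: x) = conjc c *: conj x.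
Hypothesis D_conj : forall x, D (conj x) = conj (D x).

(** The flow [exp (t D)] contracts [q], so the integral of [exp (t D) (q * conj q)] over
    the positive half-line should be the sum sought; it is built here by induction on the
    annihilator of [q]. Let [mu] be the first element of the
    annihilator and [r = D q - mu *: q], which the rest [s] of it kills. As
    [- conjc mu] lies in the right half-plane, it is not in [s], so the equation
    [D t + conjc mu *: t = - r] has a solution [t] that [s] kills. Then [g = q + t] has
    derivative [mu *: q - conjc mu *: t], and [hermitian_step] expresses [q * conj q]
    through the derivative of [g * conj g] and [t * conj t]. *)
Lemma hermitian_square_primitive (s : seq R[i]) q :
  {in s, forall mu : R[i], Re mu < 0} -> annihilates D s q ->
  exists2 gs : seq E, (forall g, g \in gs -> annihilates D s g)
    & q * conj q = - D (\sum_(g <- gs) g * conj g).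
Proof.
elim: s q => [|mu s IHs] q.
  by move=> _ /= ->; exists [::]; rewrite ?big_nil ?linear0 ?mul0r ?oppr0.
move=> s_neg /= hq.
have mu_neg : Re mu < 0 by apply: s_neg; rewrite inE eqxx.
have s'_neg : {in s, forall nu : R[i], Re nu < 0}.
  by move=> nu s_nu; apply: s_neg; rewrite inE s_nu orbT.
have conj_notin : - conjc mu \notin s.
  apply/negP => /s'_neg; case: (mu) mu_neg => a b /= a_lt0.
  by rewrite oppr_lt0 => /(lt_trans a_lt0); rewrite ltxx.
have [t ht Dt] := annihilates_solve conj_notin (annihilatesZ (-1) hq).
have [gs hgs tE] := IHs t s'_neg ht.
(* [b ^+ 2] is the inverse of [- 2 * Re mu]. *)
pose b : R[i] := (Num.sqrt (- (Re mu + Re mu)))^-1%:C.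
have bE : b * b * (mu + conjc mu) = -1.
  have d_gt0 : 0 < - (Re mu + Re mu) by rewrite oppr_gt0 -mulr2n pmulrn_llt0.
  rewrite /b; case: (mu) d_gt0 => x y /= d_gt0.
  have -> : (x +i* y) + (x -i* y) = (- (- (x + x)))%:C.
    by rewrite opprK; apply/eqP; rewrite eq_complex /= subrr !eqxx.
  rewrite -!rmorphM /= mulrN -invfM -expr2 sqr_sqrtr ?ltW // mulVf ?gt_eqF //.
  by rewrite rmorphN.
exists (b *: (q + t) :: gs).
  move=> g; rewrite inE => /orP[/eqP -> | /hgs hg]; last exact: annihilates_shift.
  apply: (annihilatesZ (s := mu :: s)).
  by apply: annihilatesD => //; apply: annihilates_shift.
have Dg : D (q + t) = mu *: q - conjc mu *: t.
  rewrite linearD /=; rewrite scaleNr opprK scaleN1r opprB in Dt.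
  by rewrite -[D t](addrK (conjc mu *: t)) Dt addrA subrKC.
have Dcg : D (conj (q + t)) = conjc mu *: conj q - mu *: conj t.
  by rewrite D_conj Dg rmorphB /= !conjZ conjcK.
have key : D ((q + t) * conj (q + t)) = (mu + conjc mu) *: (q * conj q - t * conj t).
  by rewrite Dmul Dg Dcg rmorphD; apply: hermitian_step.
have normE : b *: (q + t) * conj (b *: (q + t)) = (b * b) *: ((q + t) * conj (q + t)).
  by rewrite conjZ conjc_real -scalerAl -scalerAr scalerA.
by rewrite big_cons linearD opprD -tE normE linearZ /= key scalerA bE scaleN1r opprK subrK.
Qed.
End HermitianSquares.

(** * Polynomials without constant term are stable torsion elements *)

Section Hurwitz.
Variables (R : rcfType) (n : nat) (A : 'M[R[i]]_n).
Implicit Types (p : {mpoly R[i][n]}) (s : seq R[i]).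

Definition stable_torsion p :=
  exists2 s, {in s, forall mu : R[i], Re mu < 0} & annihilates (lie A) s p.

(** Reduces the annihilation of the variables to Cayley-Hamilton for [A]. *)
Lemma annihilates_linear_form s (u : 'rV[R[i]]_n) :
  u *m (\big[mulmx/1%:M]_(mu <- s) (A - mu%:M)) = 0 ->
  annihilates (lie A) s (linear_form u).
Proof.
elim: s u => [|mu s IHs] u /=.
  by rewrite big_nil mulmx1 => ->; rewrite /linear_form big1 // => j _; rewrite mxE scale0r.
rewrite big_cons mulmxA => /IHs.
rewrite lie_linear_form; congr annihilates.
rewrite /linear_form scaler_sumr -sumrB; apply: eq_bigr => j _.
by rewrite mulmxBr mul_mx_scalar !mxE scalerBl scalerA.
Qed.

Hypothesis A_hurwitz : forall mu : R[i], root (char_poly A) mu -> Re mu < 0.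

Lemma stable_torsionX i : stable_torsion 'X_i.
Proof.
have [s cE] := closed_field_poly_normal (char_poly A).
rewrite (monicP (char_poly_monic A)) scale1r in cE.
exists s => [mu|]; first by rewrite -root_prod_XsubC -cE; apply: A_hurwitz.
have -> : 'X_i = linear_form (row i 1%:M) :> {mpoly R[i][n]}.
  rewrite /linear_form (bigD1 i) //= big1 => [|j ji].
    by rewrite !mxE eqxx scale1r addr0.
  by rewrite !mxE eq_sym (negPf ji) scale0r.
apply: annihilates_linear_form.
case: n i A cE => [[]//|n'] i B cE.
have := Cayley_Hamilton B; rewrite cE rmorph_prod /= => h.
suff -> : \big[mulmx/1%:M]_(mu <- s) (B - mu%:M) = 0 by rewrite mulmx0.
rewrite -[RHS]h; apply: eq_bigr => mu _.
by rewrite rmorphB /= horner_mx_X horner_mx_C.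
Qed.

(** A polynomial without constant term is a combination of products of variables, and
    stable torsion elements are closed under sums and products. *)
Lemma stable_torsion_mcoeff0 p : p@_0%MM = 0 -> stable_torsion p.
Proof.
have tD q r : stable_torsion q -> stable_torsion r -> stable_torsion (q + r).
  move=> [s sneg hs] [t tneg ht]; exists (s ++ t).
    by move=> mu; rewrite mem_cat => /orP[/sneg | /tneg].
  by apply: annihilatesD; [apply: annihilates_catl | apply: annihilates_catr].
have tM q r : stable_torsion q -> stable_torsion r -> stable_torsion (q * r).
  move=> [s sneg hs] [t tneg ht].
  apply: (annihilatesM (lieM A) (P := fun mu => Re mu < 0)) sneg tneg hs ht.
  move=> [a ?] [b ?] /= a0 b0; rewrite -oppr_gt0 opprD; apply: addr_gt0; by rewrite oppr_gt0.
have tZ c q : stable_torsion q -> stable_torsion (c *: q).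
  by move=> [s sneg hs]; exists s => //; apply: annihilatesZ.
(* The polynomials that are stable torsion up to their constant term form a
   subalgebra. *)
suff h q : stable_torsion (q - (q@_0%MM)%:MP).
  by move=> p0; have := h p; rewrite p0 mpolyC0 subr0.
elim/mpoly_ring_ind: q => [c|i|q r hq hr|q r hq hr].
- by rewrite mcoeffC eqxx mulr1 subrr; exists [::].
- by rewrite mcoeffX -mdeg_eq0 mdeg1 mpolyC0 subr0; apply: stable_torsionX.
- by rewrite mcoeffD mpolyCD opprD addrACA; apply: tD.
- rewrite rmorphM /= rmorphM /=.
  set c := q@_0%MM; set d := r@_0%MM.
  have -> : q * r - c%:MP * d%:MP
    = (q - c%:MP) * (r - d%:MP) + (c *: (r - d%:MP) + d *: (q - c%:MP)).
    by rewrite -!mul_mpolyC; ring.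
  by apply: (tD); [apply: tM | apply: (tD); apply: tZ].
Qed.

(** A Hurwitz linear system has no polynomial first integral besides the constants:
    0 is not in the left half-plane, so [lie A] is injective on torsion elements. *)
Lemma lie_eq0 p : lie A p = 0 -> p = (p@_0%MM)%:MP.
Proof.
move=> Dp0; apply/eqP; rewrite -subr_eq0; apply/eqP.
have [|s sneg hs] := stable_torsion_mcoeff0 (p := p - (p@_0%MM)%:MP).
  by rewrite mcoeffB mcoeffC eqxx mulr1 subrr.
apply: annihilates_ker hs _; first by apply/negP => /sneg; rewrite /= ltxx.
by rewrite linearB /= lieC Dp0 subrr.
Qed.

End Hurwitz.

Lemma annihilates_mcoeff0 (K : fieldType) n (A : 'M[K]_n) s p :
  0 \notin s -> annihilates (lie A) s p -> p@_0%MM = 0.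
Proof.
elim: s p => [|mu s IHs] p /=; first by move=> _ ->; rewrite mcoeff0.
rewrite inE negb_or => /andP[mu0 s0] /(IHs _ s0).
rewrite mcoeffB mcoeffZ lie_mcoeff0 sub0r => /eqP.
by rewrite oppr_eq0 mulf_eq0 eq_sym (negPf mu0) => /eqP.
Qed.

(** * From Hermitian squares to sums of squares of real polynomials *)

Section SquareRootMinusOne.
Variables (E : comNzRingType) (j : E).
Hypothesis j_sqr : j * j = -1.

Lemma gauss_mul (a b c d : E) :
  (a + j * b) * (c + j * d) = a * c - b * d + j * (a * d + b * c).
Proof. by rewrite -[- (b * d)]mulN1r -j_sqr; ring. Qed.

Lemma gauss_norm (a b : E) : (a + j * b) * (a + - j * b) = a * a + b * b.
Proof. by rewrite -[b * b]mul1r -[1]opprK -j_sqr; ring. Qed.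

End SquareRootMinusOne.

(** Locked, like [conj_mpoly], lest unification compare the two by unfolding them, which
    is very slow. *)
HB.lock Definition complexify (R : rcfType) (n : nat) (p : {mpoly R[n]}) : {mpoly R[i][n]} :=
  map_mpoly (real_complex R) p.

HB.lock Definition conj_mpoly (R : rcfType) (n : nat) (g : {mpoly R[i][n]}) :
  {mpoly R[i][n]} := map_mpoly (@conjc R) g.

Section RealImag.
Variables (R : rcfType) (n : nat).
Implicit Types (p q r : {mpoly R[n]}) (g : {mpoly R[i][n]}).
Local Notation complexify := (@complexify R n).
Local Notation conj_mpoly := (@conj_mpoly R n).
Local Notation iM := (('i%C : R[i])%:MP : {mpoly R[i][n]}).

Fact complexify_is_additive : additive complexify.
Proof. by rewrite unlock; exact: rmorphB. Qed.
Fact complexify_is_multiplicative : multiplicative complexify.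
Proof. by rewrite unlock; split; [exact: rmorphM | exact: rmorph1]. Qed.
HB.instance Definition _ := GRing.isAdditive.Build _ _ complexify complexify_is_additive.
HB.instance Definition _ :=
  GRing.isMultiplicative.Build _ _ complexify complexify_is_multiplicative.

Fact conj_mpoly_is_additive : additive conj_mpoly.
Proof. by rewrite unlock; exact: rmorphB. Qed.
Fact conj_mpoly_is_multiplicative : multiplicative conj_mpoly.
Proof. by rewrite unlock; split; [exact: rmorphM | exact: rmorph1]. Qed.
HB.instance Definition _ := GRing.isAdditive.Build _ _ conj_mpoly conj_mpoly_is_additive.
HB.instance Definition _ :=
  GRing.isMultiplicative.Build _ _ conj_mpoly conj_mpoly_is_multiplicative.

Lemma complexify_coef p m : (complexify p)@_m = (p@_m)%:C.
Proof. rewrite unlock; exact: mcoeff_map_mpoly. Qed.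
Lemma complexifyC c : complexify c%:MP = (c%:C)%:MP.
Proof. rewrite unlock; exact: map_mpolyC. Qed.
Lemma complexifyX m : complexify 'X_[m] = 'X_[m].
Proof. rewrite unlock; exact: map_mpolyX. Qed.
Lemma conj_coef g m : (conj_mpoly g)@_m = conjc g@_m.
Proof. rewrite unlock; exact: mcoeff_map_mpoly. Qed.
Lemma conj_mpolyC c : conj_mpoly c%:MP = (conjc c)%:MP.
Proof. rewrite unlock; exact: map_mpolyC. Qed.
Lemma conj_mpolyZ c g : conj_mpoly (c *: g) = conjc c *: conj_mpoly g.
Proof. rewrite unlock; exact: map_mpolyZ. Qed.

Lemma conj_complexify p : conj_mpoly (complexify p) = complexify p.
Proof. by apply/mpolyP => m; rewrite (conj_coef (complexify p)) (complexify_coef p) conjc_real. Qed.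

Let iM_sqr : iM * iM = -1.
Proof. by rewrite -mpolyCM -expr2 sqr_i mpolyCN mpolyC1. Qed.

Lemma mpoly_real_imag g : exists q r, g = complexify q + iM * complexify r.
Proof.
elim/mpoly_ring_ind: g => [c|i|p1 p2 [q1 [r1 ->]] [q2 [r2 ->]]|p1 p2 [q1 [r1 ->]] [q2 [r2 ->]]].
- exists (Re c)%:MP, (Im c)%:MP.
  by rewrite !complexifyC -mpolyCM -mpolyCD -complexE.
- by exists 'X_i, 0; rewrite complexifyX rmorph0 mulr0 addr0.
- by exists (q1 + q2), (r1 + r2); rewrite !rmorphD mulrDr addrACA.
- exists (q1 * q2 - r1 * r2), (q1 * r2 + r1 * q2).
  by rewrite rmorphB rmorphD !rmorphM; apply: gauss_mul.
Qed.

Lemma mul_conj_sum_sqr g :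
  exists q r, g * conj_mpoly g = complexify (q ^+ 2 + r ^+ 2).
Proof.
have [q [r ->]] := mpoly_real_imag g; exists q, r.
have conj_i : conjc 'i%C = - 'i%C :> R[i].
  by apply/eqP; rewrite eq_complex /= oppr0 !eqxx.
rewrite rmorphD rmorphM /= conj_mpolyC (conj_complexify q) (conj_complexify r) conj_i mpolyCN.
rewrite (gauss_norm iM_sqr).
by rewrite !expr2 (rmorphD complexify) (rmorphM complexify q) (rmorphM complexify r).
Qed.

End RealImag.

Section RealPrimitive.
Variables (R : rcfType) (n : nat) (A : 'M[R]_n).
Local Notation Ac := (map_mx (real_complex R) A).

Lemma complexify_inj : injective (@complexify R n).
Proof.
move=> p q pq; apply/mpolyP => m; apply: (@complexI R).
by rewrite -!complexify_coef pq.
Qed.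

Lemma lie_complexify (p : {mpoly R[n]}) : lie Ac (complexify p) = complexify (lie A p).
Proof. by rewrite unlock lie_map. Qed.

Lemma lie_conj (g : {mpoly R[i][n]}) : lie Ac (conj_mpoly g) = conj_mpoly (lie Ac g).
Proof.
have AcJ : map_mx (@conjc R) Ac = Ac.
  by apply/matrixP => i j; rewrite !mxE; apply: conjc_real.
by rewrite unlock (lie_map (@conjc R)) AcJ.
Qed.

Lemma sum_mul_conj (gs : seq {mpoly R[i][n]}) :
  exists hs : seq {mpoly R[n]},
    \sum_(g <- gs) g * conj_mpoly g = complexify (\sum_(h <- hs) h ^+ 2).
Proof.
elim: gs => [|g gs [hs hsE]]; first by exists [::]; rewrite !big_nil rmorph0.
have [q [r qrE]] := mul_conj_sum_sqr g.
exists (q :: r :: hs).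
by rewrite !big_cons hsE qrE addrA (rmorphD (@complexify R n) (q ^+ 2 + r ^+ 2)).
Qed.

Hypothesis Ac_hurwitz : forall mu : R[i], root (char_poly Ac) mu -> Re mu < 0.

Lemma sqr_primitive (q : {mpoly R[n]}) : q@_0%MM = 0 ->
  exists2 hs : seq {mpoly R[n]},
    (\sum_(h <- hs) h ^+ 2)@_0%MM = 0 & q ^+ 2 = - lie A (\sum_(h <- hs) h ^+ 2).
Proof.
move=> q0.
have [|s s_neg hs] := stable_torsion_mcoeff0 Ac_hurwitz (p := complexify q).
  by rewrite complexify_coef q0.
have [gs gs_s gsE] := hermitian_square_primitive (conj := @conj_mpoly R n)
  (lieM Ac) (@conj_mpolyZ R n) lie_conj s_neg hs.
have s0 : 0 \notin s by apply/negP => /s_neg; rewrite /= ltxx.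
have [hs' hsE] := sum_mul_conj gs.
exists hs'.
  apply: (@complexI R); rewrite -complexify_coef -hsE raddf_sum /=.
  rewrite big_seq big1 // => g /gs_s /(annihilates_mcoeff0 s0) g0.
  by rewrite rmorphM /= g0 mul0r.
apply: complexify_inj.
rewrite (rmorphN (@complexify R n)) /= -lie_complexify -hsE -gsE /= conj_complexify.
by rewrite expr2 (rmorphM (@complexify R n)).
Qed.

(** At the origin, [- lie A V] vanishes and equals the sum of the squares of the constant
    terms of the [q]; hence these constant terms are 0 and [sqr_primitive] applies. *)
Lemma sos_primitive (V : {mpoly R[n]}) (qs : seq {mpoly R[n]}) :
  - lie A V = \sum_(q <- qs) q ^+ 2 ->
  exists hs : seq {mpoly R[n]}, V = (V@_0%MM)%:MP + \sum_(h <- hs) h ^+ 2.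
Proof.
move=> SE.
have q0 : {in qs, forall q : {mpoly R[n]}, q@_0%MM = 0}.
  have : \sum_(q <- qs) q@_0%MM ^+ 2 = 0.
    transitivity ((\sum_(q <- qs) q ^+ 2)@_0%MM).
      by rewrite raddf_sum /=; apply: eq_bigr => r _; rewrite rmorphXn.
    by rewrite -SE mcoeffN lie_mcoeff0 oppr0.
  move=> /eqP; rewrite psumr_eq0 => [|r _]; last exact: sqr_ge0.
  by move=> /allP h q /h; rewrite /= sqrf_eq0 => /eqP.
have [hs hs0 hsE] : exists2 hs : seq {mpoly R[n]},
    (\sum_(h <- hs) h ^+ 2)@_0%MM = 0
    & \sum_(q <- qs) q ^+ 2 = - lie A (\sum_(h <- hs) h ^+ 2).
  elim: (qs) q0 => [|q s IHs] q0.
    by exists [::]; rewrite !big_nil ?linear0 ?oppr0 ?mcoeff0.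
  have [|hs Z1 E1] := @sqr_primitive q; first by apply: q0; rewrite inE eqxx.
  have [|hs' Z2 E2] := IHs; first by move=> r sr; apply: q0; rewrite inE sr orbT.
  exists (hs ++ hs'); rewrite ?big_cons big_cat /=.
    by rewrite mcoeffD Z1 Z2 addr0.
  by rewrite linearD opprD -E1 -E2.
exists hs.
have : lie Ac (complexify (V - \sum_(h <- hs) h ^+ 2)) = 0.
  by rewrite lie_complexify linearB /= -(opprK (lie A V)) SE hsE opprK subrr rmorph0.
move=> /(lie_eq0 Ac_hurwitz); rewrite complexify_coef -complexifyC => /complexify_inj.
by rewrite mcoeffB hs0 subr0 => <-; rewrite subrK.
Qed.

End RealPrimitive.

(** * A positive definite Lyapunov function forces a Hurwitz matrix *)

(** If the leading coefficient of [p] were negative, then so would be [p] far out; so it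
    is positive, and far out [p^`()] is positive too. *)
Lemma pos_poly_monotone_sign (R : rcfType) (p : {poly R}) (a : R) :
  (forall r, 0 < r -> 0 < p.[r]) -> (forall r, 0 < r -> a * p^`().[r] < 0) ->
  a < 0.
Proof.
move=> p_pos p'_sign.
have large (q : {poly R}) : 0 < lead_coef q -> exists2 r, 0 < r & 0 < q.[r].
  move=> lq; have [x hx] := poly_pinfty_gt_lc lq.
  exists (Num.max 1 x); first by rewrite lt_max ltr01.
  by apply: lt_le_trans lq (hx _ _); rewrite le_max lexx orbT.
have lp_ge0 : 0 <= lead_coef p.
  rewrite leNgt; apply/negP; rewrite -oppr_gt0 -lead_coefN => /large[r r0].
  by rewrite hornerN oppr_gt0 => /(lt_trans (p_pos r r0)); rewrite ltxx.
have p'_neq0 : p^`() != 0.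
  by apply/eqP => p'0; have := p'_sign 1 ltr01; rewrite p'0 horner0 mulr0 ltxx.
have lp' : 0 < lead_coef p^`().
  have sz : (1 < size p)%N.
    by move: p'_neq0; rewrite -size_poly_gt0 size_deriv; case: (size p) => [|[]].
  have p_neq0 : p != 0 by apply/eqP => p0; rewrite p0 size_poly0 in sz.
  have lp : 0 < lead_coef p by rewrite lt_def lead_coef_eq0 p_neq0.
  move: lp sz; rewrite !lead_coefE size_deriv coef_deriv.
  by case: (size p) => [|[|k]] //= lp _; rewrite pmulrn_lgt0.
have [r r0 p'r] := large _ lp'.
by have := p'_sign r r0; rewrite pmulr_llt0.
Qed.

Section PositiveDefinite.
Variables (R : rcfType) (n : nat) (V : {mpoly R[n]}).
Hypothesis n_gt0 : (0 < n)%N.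
Hypothesis V_pos : forall (x : 'I_n -> R) j, x j != 0 -> 0 < V.@[x].

(** Only the value at the origin is at stake. If it were negative, then by the
    intermediate value theorem [V] would vanish at another point of the diagonal. *)
Lemma posdef_ge0 (x : 'I_n -> R) : 0 <= V.@[x].
Proof.
have [/existsP[j xj]|] := boolP [exists j, x j != 0]; first exact: ltW (V_pos xj).
rewrite negb_exists => /forallP x0.
pose p := mmap (@polyC R) (fun _ => 'X) V.
have pE s : p.[s] = V.@[fun _ => s].
  rewrite /p; elim/mpoly_ring_ind: (V) => [c|i|q r hq hr|q r hq hr].
  - by rewrite mmapC hornerC mevalC.
  - by rewrite mmapX mmap1U hornerX mevalXU.
  - by rewrite mmapD hornerD mevalD hq hr.
  - by rewrite rmorphM hornerM mevalM hq hr.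
have -> : V.@[x] = p.[0].
  by rewrite pE; apply: meval_eq => j; have := x0 j; rewrite negbK => /eqP.
rewrite leNgt; apply/negP => p0.
have p_pos s : s != 0 -> 0 < p.[s] by rewrite pE; apply: (V_pos (j := Ordinal n_gt0)).
have [|s _ /eqP ps] := poly_ivt (p := p) (@ler01 R).
  by rewrite ltW //= ltW // p_pos ?oner_neq0.
have [s0|/p_pos] := eqVneq s 0; last by rewrite ps ltxx.
by rewrite s0 in ps; rewrite ps ltxx in p0.
Qed.
End PositiveDefinite.

(** Over [R[i]] the separable polynomial ['X^N - 1] splits, so it has [N] distinct roots. *)
Lemma prim_root_complex (R : rcfType) N :
  (0 < N)%N -> exists z : R[i], N.-primitive_root z.
Proof.
move=> N_gt0; pose p : {poly R[i]} := 'X^N - 1.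
have [r Dp] := closed_field_poly_normal p.
rewrite (monicP _) ?monicXnsubC // scale1r in Dp.
have rn1 : all N.-unity_root r by apply/allP=> z; rewrite -root_prod_XsubC -Dp.
have sz_r : (N < (size r).+1)%N.
  by rewrite -(size_prod_XsubC r id) -Dp size_XnsubC.
have [|z] := hasP (has_prim_root N_gt0 rn1 _ sz_r); last by exists z.
by rewrite -separable_prod_XsubC -Dp separable_Xn_sub_1 // pnatr_eq0 -lt0n.
Qed.

(** Orthogonality of the characters of the cyclic group of order [N]. *)
Lemma sum_prim_root (K : fieldType) N (z : K) (i j : nat) :
  N.-primitive_root z -> (i < N)%N -> (j < N)%N ->
  \sum_(k < N) (z ^+ k) ^+ i * (z ^- k) ^+ j = if i == j then N%:R else 0.
Proof.
move=> z_prim iN jN.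
have z_neq0 : z != 0.
  by apply/eqP => z0; move: (prim_expr_order z_prim); rewrite z0 expr0n
     gtn_eqF ?(prim_order_gt0 z_prim) //= => /eqP; rewrite eq_sym oner_eq0.
transitivity (\sum_(k < N) (z ^+ i / z ^+ j) ^+ k).
  by apply: eq_bigr => k _; rewrite exprVn expr_div_n -!exprM [(k * i)%N]mulnC [(k * j)%N]mulnC.
case: eqVneq => [<-|ij].
  rewrite divff ?expf_neq0 // (eq_bigr (fun _ => 1)) => [|k _]; last by rewrite expr1n.
  by rewrite sumr_const card_ord.
set w := _ / _.
have w_neq1 : w - 1 != 0.
  rewrite subr_eq0; apply/eqP => /(canRL (mulfVK _)); rewrite mul1r expf_neq0 // => /(_ isT).
  by move/eqP; rewrite (eq_prim_root_expr z_prim) !modn_small // (negPf ij).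
apply: (mulfI w_neq1); rewrite mulr0 -subrX1 /w expr_div_n -!exprM.
by rewrite ![(_ * N)%N]mulnC !exprM (prim_expr_order z_prim) !expr1n divr1 subrr.
Qed.

(** Averaging over the rotations by roots of unity keeps the monomials that are invariant
    under [(X_0, X_1) |-> (z * X_0, z^-1 * X_1)], i.e. the powers of [X_0 * X_1]; a root of
    order greater than all exponents does not confuse them with others. *)
Lemma average_meval (K : fieldType) N (z t : K) (s : seq 'X_{1..2}) (c : 'X_{1..2} -> K) :
  N.-primitive_root z -> (forall m j, m \in s -> (m j < N)%N) ->
  \sum_(k < N) (\sum_(m <- s) c m *: 'X_[m] : {mpoly K[2]}).@[fun j =>
      if j == 0 then t * z ^+ k else t * z ^- k]
  = N%:R * \sum_(m <- s | m 0 == m 1) c m * (t * t) ^+ m 0.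
Proof.
move=> z_prim s_lt.
under eq_bigr do rewrite raddf_sum /=.
rewrite exchange_big /= mulr_sumr [RHS]big_mkcond /=.
rewrite big_seq [RHS]big_seq; apply: eq_bigr => m ms.
under eq_bigr do rewrite mevalZ mevalX big_ord_recl big_ord1 /=.
rewrite -mulr_sumr.
transitivity (c m * (t ^+ m 0 * t ^+ m 1 * \sum_(k < N) (z ^+ k) ^+ m 0 * (z ^- k) ^+ m 1)).
  congr (_ * _); rewrite mulr_sumr; apply: eq_bigr => k _.
  by rewrite (_ : lift _ _ = 1) ?[ord0]/0; [rewrite !exprMn mulrACA | exact/val_inj].
rewrite (sum_prim_root z_prim) ?s_lt //; case: eqP => [<-|_]; last by rewrite !mulr0.
by rewrite exprMn [RHS]mulrC !mulrA.
Qed.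

(** Monomials are eigenvectors of the derivation of a diagonal system. *)
Lemma lie_diagX (K : comNzRingType) n (d : 'rV[K]_n) (m : 'X_{1..n}) :
  lie (diag_mx d) 'X_[m] = (\sum_i (m i)%:R * d 0 i) *: 'X_[m].
Proof.
rewrite scaler_suml; apply: eq_bigr => i _.
have -> : linear_form (row i (diag_mx d)) = d 0 i *: 'X_i.
  rewrite /linear_form (bigD1 i) //= big1 => [|j ji].
    by rewrite !mxE eqxx mulr1n addr0.
  by rewrite !mxE eq_sym (negPf ji) mulr0n scale0r.
rewrite mderivX -scalerAl -scalerAr scalerA.
have [->|mi] := eqVneq (m i) 0%N; first by rewrite mul0r !scale0r.
by rewrite -mpolyXD submK // lep1mP.
Qed.

Lemma lie_diag_mpolyE (K : comNzRingType) n (d : 'rV[K]_n) (p : {mpoly K[n]}) :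
  lie (diag_mx d) p
  = \sum_(m <- msupp p) (p@_m * \sum_i (m i)%:R * d 0 i) *: 'X_[m].
Proof.
rewrite {1}(mpolyE p) linear_sum; apply: eq_bigr => m _ /=.
by rewrite linearZ /= lie_diagX scalerA.
Qed.

Definition linear_subst (K : comNzRingType) n m (M : 'M[K]_(n, m)) (p : {mpoly K[n]}) :
  {mpoly K[m]} := p \mPo [tuple linear_form (row i M) | i < n].

(** If the linear map [M] carries the flow of [B] to the flow of [A], then composition
    with [M] commutes with differentiation along the flows. *)
Lemma lie_linear_subst (K : comNzRingType) n m (A : 'M[K]_n) (B : 'M[K]_m)
    (M : 'M[K]_(n, m)) p :
  A *m M = M *m B -> lie B (linear_subst M p) = linear_subst M (lie A p).
Proof.
move=> AM; apply: lie_comp => i.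
rewrite tnth_mktuple lie_linear_form -row_mul -AM lieX /linear_form.
rewrite raddf_sum /=; under [RHS]eq_bigr do
  rewrite comp_mpolyZ comp_mpolyXU -tnth_nth tnth_mktuple scaler_sumr.
rewrite exchange_big /=; apply: eq_bigr => j _.
rewrite !mxE scaler_suml; apply: eq_bigr => k _.
by rewrite scalerA !mxE.
Qed.

Lemma meval_linear_subst (K : comNzRingType) n m (M : 'M[K]_(n, m)) p (z : 'I_m -> K) :
  (linear_subst M p).@[z] = p.@[fun i => \sum_j M i j * z j].
Proof.
rewrite comp_mpoly_meval; apply: meval_eq => i.
rewrite tnth_mktuple raddf_sum /=; apply: eq_bigr => j _.
by rewrite mevalZ mevalXU mxE.
Qed.

Lemma meval_complexify (R : rcfType) n (p : {mpoly R[n]}) (x : 'I_n -> R) :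
  (complexify p).@[fun i => (x i)%:C] = (p.@[x])%:C.
Proof.
elim/mpoly_ring_ind: p => [c|i|q r hq hr|q r hq hr].
- by rewrite complexifyC !mevalC.
- by rewrite complexifyX !mevalXU.
- by rewrite rmorphD /= !mevalD hq hr rmorphD.
- by rewrite rmorphM /= !mevalM hq hr rmorphM.
Qed.

Lemma eigenvector_normalized (K : fieldType) n (A : 'M[K]_n) (a : K) :
  root (char_poly A) a ->
  exists (v : 'cV[K]_n) (j : 'I_n), A *m v = a *: v /\ v j 0 = 1.
Proof.
have -> : char_poly A = char_poly A^T.
  rewrite /char_poly -det_tr; congr (\det _).
  by apply/matrixP => i j; rewrite !mxE eq_sym.
rewrite -eigenvalue_root_char => /eigenvalueP[u uA /rV0Pn[j uj]].
exists ((u 0 j)^-1 *: u^T), j; split; last by rewrite !mxE mulVf.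
rewrite -scalemxAr -[A *m _]trmxK trmx_mul trmxK uA linearZ /= scalerA mulrC.
by rewrite -scalerA.
Qed.

Lemma Re_add (R : rcfType) (a b : R[i]) : Re (a + b) = Re a + Re b.
Proof. by case: a b => [a a'] [b b']. Qed.

Lemma Re_mulr (R : rcfType) (a : R) (b : R[i]) : Re (a%:C * b) = a * Re b.
Proof. by case: b => b b' /=; rewrite mul0r subr0. Qed.

(** The columns [v] and [conjc v] of [M] span an invariant plane on which the system is
    diagonal with entries [mu] and [conjc mu]. Averaging over the points
    [2 * Re (sqrt r * z ^+ k * v)], where [z] is a root of unity, yields the polynomial [P]
    in [r] to which [pos_poly_monotone_sign] applies. *)
Lemma hurwitz_of_lyapunov (R : rcfType) n (A : 'M[R]_n) (V : {mpoly R[n]}) :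
  (forall (x : 'I_n -> R) j, x j != 0 -> 0 < V.@[x]) ->
  (forall (x : 'I_n -> R) j, x j != 0 -> 0 < (- lie A V).@[x]) ->
  forall mu : R[i], root (char_poly (map_mx (real_complex R) A)) mu -> Re mu < 0.
Proof.
move=> V_pos L_pos mu /eigenvector_normalized[v [j0 [Av vj0]]].
have n_gt0 : (0 < n)%N by apply: leq_ltn_trans (ltn_ord j0).
pose Ac := map_mx (real_complex R) A.
pose M : 'M[R[i]]_(n, 2) := \matrix_(i, j) if j == 0 then v i 0 else conjc (v i 0).
pose d : 'rV[R[i]]_2 := \row_j if j == 0 then mu else conjc mu.
have AM : Ac *m M = M *m diag_mx d.
  apply/matrixP => i j; rewrite mul_mx_diag !mxE.
  under eq_bigr do rewrite !mxE.
  have Avi : \sum_k (A i k)%:C * v k 0 = v i 0 * mu.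
    move/matrixP/(_ i 0): Av; rewrite !mxE mulrC => <-.
    by apply: eq_bigr => k _; rewrite mxE.
  case: eqP => // _; rewrite -rmorphM -Avi rmorph_sum /=.
  by apply: eq_bigr => k _; rewrite rmorphM /=; congr (_ * _); apply/esym/conjc_real.
pose W := linear_subst M (complexify V).
(* Exceeds every exponent that occurs in [W]. *)
pose N := (msize W).+1.
have W_lt m (j : 'I_2) : m \in msupp W -> (m j < N)%N.
  move=> /msize_mdeg_lt mW; rewrite ltnS; apply: leq_trans (ltnW mW).
  by rewrite mdegE (bigD1 j) //= leq_addr.
have [z z_prim] := @prim_root_complex R N isT.
have conj_z k : conjc (z ^+ k) = z ^- k.
  have nz : `|z| = 1.
    apply/eqP; rewrite -(@pexpr_eq1 _ _ N) // -normrX (prim_expr_order z_prim).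
    by rewrite normr1.
  have zz : conjc z * z = 1 by rewrite mulrC -sqr_normc nz expr1n.
  have z_neq0 : z != 0 by rewrite -normr_eq0 nz oner_neq0.
  by rewrite rmorphXn /= -exprVn -[z^-1]mul1r -zz mulfK.
pose x (r : R) (k : 'I_N) (i : 'I_n) : R := 2 * Re (v i 0 * ((Num.sqrt r)%:C * z ^+ k)).
have evalE (p : {mpoly R[n]}) (r : R) (k : 'I_N) : (linear_subst M (complexify p)).@[fun j =>
      if j == 0 then (Num.sqrt r)%:C * z ^+ k else (Num.sqrt r)%:C * z ^- k]
    = (p.@[x r k])%:C.
  rewrite meval_linear_subst -meval_complexify; apply: meval_eq => i.
  rewrite big_ord_recl big_ord1 !mxE /=.
  rewrite rmorphM /= -conj_z -[X in _ + _ * (X * _)]conjc_real.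
  by rewrite -!rmorphM /= addcJ /x [RHS]rmorphM rmorph_nat.
pose P : {poly R} := \sum_(m <- msupp W | m 0 == m 1) Re W@_m *: 'X^(m 0).
have average (p : {mpoly R[n]}) c r : 0 < r ->
    linear_subst M (complexify p) = \sum_(m <- msupp W) c m *: 'X_[m] ->
    \sum_(k < N) p.@[x r k]
    = N%:R * \sum_(m <- msupp W | m 0 == m 1) Re (c m) * r ^+ m 0.
  move=> r_gt0 pE.
  have := average_meval (Num.sqrt r)%:C c z_prim W_lt.
  rewrite -pE; under eq_bigr do rewrite evalE.
  rewrite -(rmorphM (real_complex R)) /= -expr2 sqr_sqrtr ?ltW //.
  rewrite -rmorph_sum -(rmorph_nat (real_complex R)) => /(congr1 (@complex.Re R)) /= ->.
  rewrite Re_mulr; congr (_ * _).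
  rewrite (big_morph (@complex.Re R) (@Re_add R) (erefl _)).
  by apply: eq_bigr => m _; rewrite -rmorphXn mulrC Re_mulr mulrC.
have avgV r : 0 < r -> \sum_(k < N) V.@[x r k] = N%:R * P.[r].
  move=> r_gt0; rewrite (average V (fun m => W@_m)) //; last exact: mpolyE.
  by rewrite horner_sum; congr (_ * _); apply: eq_bigr => m _; rewrite hornerZ hornerXn.
have avgL r : 0 < r -> \sum_(k < N) (lie A V).@[x r k]
    = N%:R * (2 * Re mu * r * P^`().[r]).
  move=> r_gt0; rewrite (average _ (fun m => W@_m * \sum_i (m i)%:R * d 0 i) r r_gt0); last first.
    by rewrite -lie_complexify -(lie_linear_subst _ AM); apply: lie_diag_mpolyE.
  congr (_ * _); rewrite raddf_sum horner_sum mulr_sumr; apply: eq_bigr => m /eqP m01.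
  rewrite /= derivZ derivXn hornerZ hornerMn hornerXn.
  rewrite big_ord_recl big_ord1 !mxE /= (_ : lift _ _ = 1); last exact: val_inj.
  rewrite -m01 -mulrDr addcJ.
  have -> : (m 0)%:R * (2%:R * (Re mu)%:C) = ((m 0)%:R * (2 * Re mu))%:C :> R[i].
    by rewrite !(rmorphM (real_complex R)) /= !rmorph_nat.
  rewrite [W@_m * _]mulrC Re_mulr.
  case: (m 0) => [|k]; first by rewrite !mul0r mulr0n !mulr0.
  by rewrite exprS -mulr_natl /=; ring.
have x0 r : 0 < r -> x r ord0 j0 != 0.
  by move=> r0; rewrite /x expr0 mulr1 vj0 mul1r /= mulf_neq0 ?pnatr_eq0 // gt_eqF // sqrtr_gt0.
have sum_pos (p : {mpoly R[n]}) r : (forall (x : 'I_n -> R) j, x j != 0 -> 0 < p.@[x]) ->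
    0 < r -> 0 < \sum_(k < N) p.@[x r k].
  (* Some of the points may be the origin, but the one for [k = 0] is not, thanks to the
     normalization of [v]. *)
  move=> p_pos r0; rewrite big_ord_recl.
  apply: ltr_pwDl; first exact: p_pos (x0 r r0).
  by apply: sumr_ge0 => k _; apply: posdef_ge0.
apply: (@pos_poly_monotone_sign _ P) => r r0.
  by have := sum_pos V r V_pos r0; rewrite avgV // pmulr_rgt0 // ltr0n.
have := sum_pos _ r L_pos r0.
under eq_bigr do rewrite mevalN.
rewrite sumrN avgL // oppr_gt0 pmulr_rlt0 ?ltr0n //.
rewrite -mulrA -mulrA pmulr_rlt0 // mulrCA pmulr_rlt0 //.
Qed.

Local Close Scope complex_scope.

(** * The theorem *)

Lemma meval_origin (K : comNzRingType) n (p : {mpoly K[n]}) :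
  p.@[fun=> 0] = p@_0%MM.
Proof.
elim/mpoly_ring_ind: p => [c|i|p q IHp IHq|p q IHp IHq].
- by rewrite mevalC mcoeffC eqxx mulr1.
- by rewrite mevalXU mcoeffX -mdeg_eq0 mdeg1.
- by rewrite mevalD mcoeffD IHp IHq.
- by rewrite mevalM rmorphM /= IHp IHq.
Qed.

Lemma orbital_derivative_linear (R : realType) n (A : 'M[R]_n) (V : {mpoly R[n]}) :
  orbital_derivative (linear_field A) V = lie A V.
Proof.
apply: eq_bigr => i _; rewrite !mxE; congr (_ * _).
by apply: eq_bigr => j _; rewrite !mxE mul_mpolyC.
Qed.

Lemma positive_definite_coord (R : realType) n (V : {mpoly R[n]}) :
  positive_definite (mpoly_fun V) ->
  forall (x : 'I_n -> R) j, x j != 0 -> 0 < V.@[x].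
Proof.
move=> V_pos x j xj; have := V_pos (\col_i x i).
rewrite /mpoly_fun (meval_eq (v2 := x)) => [|i]; last by rewrite mxE.
by apply; apply/cV0Pn; exists j; rewrite mxE.
Qed.

Unset Implicit Arguments.

Theorem proposition3p11 (R : realType) (n : nat) (hn : (0 < n)%N)
    (A : 'M[R]_n) (V : {mpoly R[n]})
    (hV : positive_definite (mpoly_fun V))
    (hdV : positive_definite (mpoly_fun (- orbital_derivative (linear_field A) V)))
    (hsos : sos (- orbital_derivative (linear_field A) V)) :
  sos V.
Proof.
rewrite orbital_derivative_linear in hdV hsos.
have V_pos := positive_definite_coord hV.
have A_hurwitz := hurwitz_of_lyapunov V_pos (positive_definite_coord hdV).
have [qs qsE] := hsos.
have [hs VE] := sos_primitive A_hurwitz qsE.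
have V0_ge0 : 0 <= V@_0%MM.
  by rewrite -meval_origin; apply: posdef_ge0.
exists ((Num.sqrt V@_0%MM)%:MP :: hs).
by rewrite big_cons -rmorphXn /= sqr_sqrtr.
Qed.
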